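(* Let $\Phi=\{\phi_1,\dots,\phi_n\}\subset L^2(X,\rho)$ with synthesis operator $\mathcal Tc=\sum_{i=1}^n c_i\phi_i$. Given $f\in L^2(X,\rho)$, let $$E_\epsilon(c)=\|\mathcal Tc-f\|_{L^2_\rho}+\epsilon\|c\|_2,\qquad c\in\mathbb C^n,$$ and let $\hat c\in\mathbb C^n$ satisfy $$E_\epsilon(\hat c)\le C\inf_{c\in\mathbb C^n}E_\epsilon(c)$$ for some $C\ge1$ and $\epsilon\ge u\sqrt n\,\|\mathcal T\|_{2,L^2_\rho}$. Then $$\|\mathrm{fl}(\mathcal T)\hat c-\mathrm{fl}(f)\|_{L^2_\rho}\ \le\ C\inf_{c\in\mathbb C^n}\left(\|\mathcal Tc-f\|_{L^2_\rho}+\epsilon\|c\|_2\right)+u\|f\|_{L^2_\rho}.$$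
   Context: $X\subseteq\mathbb R^d$ is measurable, $\rho$ is a non-atomic probability measure on $X$, and $\|\cdot\|_{L^2_\rho}$ is the norm of the complex space $L^2(X,\rho)$. $\|\mathcal T\|_{2,L^2_\rho}=\sup_{c\ne0}\|\mathcal Tc\|_{L^2_\rho}/\|c\|_2$. No linear independence of $\Phi$ is assumed. $\mathrm{fl}:\mathbb C\to\mathbb C$ is a (measurable) rounding map with unit roundoff $u>0$: for every $y\in\mathbb C$ there is $\delta\in\mathbb C$ with $|\delta|\le u$ and $\mathrm{fl}(y)=y(1+\delta)$. For $v\in L^2(X,\rho)$, $\mathrm{fl}(v)=\mathrm{fl}\circ v\in L^2(X,\rho)$. The numerical synthesis operator is $\mathrm{fl}(\mathcal T)c=\sum_{i=1}^n c_i\,\mathrm{fl}(\phi_i)$. *)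

(* Defs.v *)
From HB Require Import structures.
From mathcomp Require Import all_boot all_order all_algebra.
From mathcomp Require Import all_classical all_reals all_analysis.
From mathcomp Require Import measurable_realfun ring.
From mathcomp Require Export complex.

Set Implicit Arguments.
Unset Strict Implicit.
Unset Printing Implicit Defensive.

Import Order.TTheory GRing.Theory Num.Theory.
Import numFieldNormedType.Exports.
Import ComplexField.

Local Open Scope classical_set_scope.
Local Open Scope ring_scope.

(* R[i] carries the Borel sigma-algebra of C = R^2: the product sigma-algebra
   of R * R transported along z |-> (Re z, Im z). *)
Definition complex_pair (R : realType) (z : R[i]) : R * R :=
  (complex.Re z, complex.Im z).

HB.instance Definition _ (R : realType) := isPointed.Build R[i] 0.

Definition complex_measurable (R : realType) : set (set R[i]) :=
  g_sigma_algebra_preimage (@complex_pair R).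

Lemma complex_measurable0 (R : realType) : complex_measurable (set0 : set R[i]).
Proof.
exact: (@measurable0 _ (g_sigma_algebra_preimageType (@complex_pair R))).
Qed.

Lemma complex_measurableC (R : realType) (A : set R[i]) :
  complex_measurable A -> complex_measurable (~` A).
Proof.
exact: (@measurableC _ (g_sigma_algebra_preimageType (@complex_pair R))).
Qed.

Lemma complex_measurable_bigcup (R : realType) (F : (set R[i])^nat) :
  (forall k, complex_measurable (F k)) -> complex_measurable (\bigcup_k F k).
Proof.
exact: (@bigcupT_measurable _ (g_sigma_algebra_preimageType (@complex_pair R))).
Qed.

HB.instance Definition _ (R : realType) :=
  @isMeasurable.Build (preimage_display (@complex_pair R)) R[i]
    (@complex_measurable R) (@complex_measurable0 R) (@complex_measurableC R)
    (@complex_measurable_bigcup R).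

Lemma measurable_fun_complexP d (T : measurableType d) (R : realType)
    (D : set T) (v : T -> R[i]) :
  measurable_fun D v <->
  measurable_fun D (fun x => complex.Re (v x)) /\
  measurable_fun D (fun x => complex.Im (v x)).
Proof.
have mpair : measurable_fun setT (@complex_pair R).
  by move=> _ B mB; rewrite setTI; exists B => //; rewrite setTI.
split=> [mv|[mRe mIm]].
  have mpv : measurable_fun D (@complex_pair R \o v).
    by apply: measurableT_comp.
  split.
    exact: (measurableT_comp measurable_fst mpv).
  exact: (measurableT_comp measurable_snd mpv).
move=> mD; have mpv : measurable_fun D (@complex_pair R \o v).
  apply: (measurability (preimage_set_system setT (@fst R R) measurable `|`
    preimage_set_system setT (@snd R R) measurable)) => //.
  move=> _ [_ [] [B mB <-] <-]; rewrite setTI.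
    exact: mRe.
  exact: mIm.
move=> A [B mB]; rewrite setTI => <-.
exact: (mpv mD B mB).
Qed.

Definition nonatomic d (T : measurableType d) (R : realType)
    (mu : set T -> \bar R) : Prop :=
  forall A : set T, measurable A -> (0 < mu A)%E ->
    exists B : set T,
      [/\ measurable B, B `<=` A, (0 < mu B)%E & (mu B < mu A)%E].

Section L2.
Context d (T : measurableType d) (R : realType).
Variables (X : set T) (mu : {measure set T -> \bar R}).

(* A function on X is represented by a total function on T of which only the
   values on X matter; almost everywhere equal functions are not identified. *)
Definition L2 (v : T -> R[i]) : Prop :=
  measurable_fun X v /\
  (\int[mu]_(x in X) (Normc.normc (v x) ^+ 2)%:E < +oo)%E.

(* A real number, meaningful only for v in L2 (fine sends +oo to 0); L2 is
   closed under synthesis and rounding by the lemmas below. *)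
Definition L2norm (v : T -> R[i]) : R :=
  Num.sqrt (fine (\int[mu]_(x in X) (Normc.normc (v x) ^+ 2)%:E)).

End L2.

Definition l2norm (R : realType) n (c : 'cV[R[i]]_n) : R :=
  Num.sqrt (\sum_(i < n) Normc.normc (c i ord0) ^+ 2).

Definition synthesis T (R : realType) n (phi : 'I_n -> T -> R[i])
    (c : 'cV[R[i]]_n) : T -> R[i] :=
  fun x => \sum_(i < n) c i ord0 * phi i x.

Definition fl_synthesis T (R : realType) n (fl : R[i] -> R[i])
    (phi : 'I_n -> T -> R[i]) : 'cV[R[i]]_n -> T -> R[i] :=
  synthesis (fun i => fl \o phi i).

(* For n = 0 the supremum is over the empty set, and sup set0 = 0. *)
Definition opnorm d (T : measurableType d) (R : realType) (X : set T)
    (mu : {measure set T -> \bar R}) n (A : 'cV[R[i]]_n -> T -> R[i]) : R :=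
  sup [set L2norm X mu (A c) / l2norm c | c in [set c | c != 0]].

Definition rounding_map (R : realType) (u : R) (fl : R[i] -> R[i]) : Prop :=
  measurable_fun setT fl /\
  forall y, exists delta : R[i],
    Normc.normc delta <= u /\ fl y = y * (1 + delta).

Section L2_closure.
Context d (T : measurableType d) (R : realType).
Variables (X : set T) (mu : {measure set T -> \bar R}).
Hypothesis mX : measurable X.

Let normc_ge0 (z : R[i]) : 0 <= Normc.normc z.
Proof. by case: z => a b; exact: sqrtr_ge0. Qed.

Let measurable_normc2 (v : T -> R[i]) : measurable_fun X v ->
  measurable_fun X (fun x => (Normc.normc (v x) ^+ 2)%:E).
Proof.
move=> /measurable_fun_complexP[mRe mIm]; apply/measurable_EFinP.
rewrite (_ : (fun x => _) = fun x =>
    complex.Re (v x) ^+ 2 + complex.Im (v x) ^+ 2); last first.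
  by apply/funext => x; case: (v x) => a b /=; rewrite sqr_sqrtr// addr_ge0 ?sqr_ge0.
by apply: measurable_funD; exact: measurable_funX.
Qed.

Let L2_dom (k : R) (v w : T -> R[i]) : 0 <= k -> measurable_fun X w ->
  (forall x, Normc.normc (w x) <= k * Normc.normc (v x)) ->
  L2 X mu v -> L2 X mu w.
Proof.
move=> k0 mw wv [mv fv]; split=> //.
apply: (@le_lt_trans _ _
  (\int[mu]_(x in X) ((k ^+ 2)%:E * (Normc.normc (v x) ^+ 2)%:E))%E).
  apply: ge0_le_integral => //.
  - by move=> x _; rewrite lee_fin sqr_ge0.
  - exact: measurable_normc2.
  - by apply: measurable_funeM; exact: measurable_normc2.
  move=> x _; rewrite -EFinM lee_fin -exprMn.
  by rewrite ler_pXn2r ?nnegrE ?mulr_ge0.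
rewrite ge0_integralZl//.
- by apply: lte_mul_pinfty => //; rewrite lee_fin sqr_ge0.
- exact: measurable_normc2.
- by move=> x _; rewrite lee_fin sqr_ge0.
- by rewrite lee_fin sqr_ge0.
Qed.

Lemma L2_fl (u : R) (fl : R[i] -> R[i]) (v : T -> R[i]) :
  rounding_map u fl -> L2 X mu v -> L2 X mu (fl \o v).
Proof.
move=> [mfl flP] v2.
have u0 : 0 <= u by have [dl [dlu _]] := flP 0; exact: le_trans dlu.
apply: (@L2_dom (1 + u) v) => //; first by rewrite addr_ge0.
  by apply: measurableT_comp => //; exact: v2.1.
move=> x /=; have [dl [dlu ->]] := flP (v x).
rewrite Normc.normcM mulrC ler_wpM2r//.
by rewrite (le_trans (le_normcD _ _))// Normc.normc1 lerD2l.
Qed.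

Lemma L2Z (a : R[i]) (v : T -> R[i]) :
  L2 X mu v -> L2 X mu (fun x => a * v x).
Proof.
move=> v2; apply: (@L2_dom (Normc.normc a) v) => //; last first.
  by move=> x; rewrite Normc.normcM.
have /measurable_fun_complexP[mRe mIm] := v2.1.
case: a => a b; apply/measurable_fun_complexP; split.
  rewrite (_ : (fun x => _) = fun x =>
      a * complex.Re (v x) - b * complex.Im (v x)); last first.
    by apply/funext => x; case: (v x).
  by apply: measurable_funB; apply: measurable_funM.
rewrite (_ : (fun x => _) = fun x =>
    a * complex.Im (v x) + b * complex.Re (v x)); last first.
  by apply/funext => x; case: (v x) => c e /=; rewrite mulrC.
by apply: measurable_funD; apply: measurable_funM.
Qed.

Lemma L2D (v w : T -> R[i]) :
  L2 X mu v -> L2 X mu w -> L2 X mu (v \+ w).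
Proof.
move=> [mv fv] [mw fw].
have /measurable_fun_complexP[vRe vIm] := mv.
have /measurable_fun_complexP[wRe wIm] := mw.
have mvw : measurable_fun X (v \+ w).
  apply/measurable_fun_complexP; split.
    rewrite (_ : (fun x => _) = fun x =>
        complex.Re (v x) + complex.Re (w x)); last first.
      by apply/funext => x /=; case: (v x) (w x) => a b [].
    exact: measurable_funD.
  rewrite (_ : (fun x => _) = fun x =>
      complex.Im (v x) + complex.Im (w x)); last first.
    by apply/funext => x /=; case: (v x) (w x) => a b [].
  exact: measurable_funD.
split=> //.
have nn (z : T -> R[i]) x : (0 <= (Normc.normc (z x) ^+ 2)%:E)%E.
  by rewrite lee_fin sqr_ge0.
apply: (@le_lt_trans _ _ (\int[mu]_(x in X)
    (2%:E * ((Normc.normc (v x) ^+ 2)%:E + (Normc.normc (w x) ^+ 2)%:E)))%E).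
  apply: ge0_le_integral => //.
  - exact: measurable_normc2.
  - by apply: measurable_funeM; apply: emeasurable_funD; exact: measurable_normc2.
  move=> x _; rewrite -EFinD -EFinM lee_fin /=.
  apply: (@le_trans _ _ ((Normc.normc (v x) + Normc.normc (w x)) ^+ 2)).
    by rewrite ler_pXn2r ?nnegrE ?addr_ge0//; exact: le_normcD.
  rewrite -subr_ge0.
  rewrite (_ : _ - _ = (Normc.normc (v x) - Normc.normc (w x)) ^+ 2) ?sqr_ge0//.
  by ring.
rewrite ge0_integralZl//; last first.
- by move=> x _; rewrite adde_ge0.
- by apply: emeasurable_funD; exact: measurable_normc2.
rewrite ge0_integralD//; [|exact: measurable_normc2|exact: measurable_normc2].
by apply: lte_mul_pinfty => //; exact: lte_add_pinfty.
Qed.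

Lemma L2_synthesis n (phi : 'I_n -> T -> R[i]) (c : 'cV[R[i]]_n) :
  (forall i, L2 X mu (phi i)) -> L2 X mu (synthesis phi c).
Proof.
move=> phi2; rewrite (_ : synthesis phi c =
    \sum_(i < n) (fun x => c i ord0 * phi i x)); last first.
  by apply/funext => x; rewrite fct_sumE.
apply: (big_ind (L2 X mu)) => [|v w|i _]; last exact: L2Z.
- split; first exact: measurable_cst.
  rewrite (_ : \int[mu]_(x in X) _ = 0)%E ?ltry//.
  by apply: integral0_eq => x _; rewrite Normc.normc0 expr0n.
- exact: L2D.
Qed.

End L2_closure.

(* Main.v *)
Require Import Defs.
From mathcomp Require Import all_boot all_order all_algebra.
From mathcomp Require Import all_classical all_reals all_analysis.
From mathcomp Require Import measurable_realfun ring lra.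

(** Rounding perturbs every function by at most [u] times its modulus,
pointwise, hence by at most [u] times its norm in L2 ([L2norm_fl_sub]).  The
residual of the rounded problem splits as

  fl(T) c - fl(f) = (T c - f) + sum_i c_i (fl(phi_i) - phi_i) + (f - fl(f)).

The last term costs [u] times the norm of [f].  By the triangle inequality the
middle one costs at most [u * sum_i |c_i| * |phi_i|].  Since [phi_i] is the
image under T of the i-th unit vector, its norm is at most the operator norm of
T ([L2norm_le_opnorm]), while Cauchy-Schwarz bounds [sum_i |c_i|] by [sqrt n]
times the l2-norm of [c] ([sum_normc_le_l2norm]).  So the middle term is at most
[u * sqrt n * |T| * |c| <= eps * |c|]: it is absorbed by the regularization term
of E, and what remains is [E c] plus [u] times the norm of [f], for every [c];
the quasi-minimality of [chat] concludes.

The triangle inequality for [L2norm] is obtained by integrating a weighted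
convexity inequality ([L2normD]). *)

Set Implicit Arguments.
Unset Strict Implicit.
Unset Printing Implicit Defensive.

Import Order.TTheory GRing.Theory Num.Theory.

Local Open Scope classical_set_scope.
Local Open Scope ring_scope.

(** * The L2 seminorm *)

Lemma normc_ge0 (R : realType) (z : R[i]) : 0 <= Normc.normc z.
Proof. by case: z => a b; exact: sqrtr_ge0. Qed.

Section L2norm_theory.
Context d (T : measurableType d) (R : realType).
Variables (X : set T) (mu : {measure set T -> \bar R}).
Hypothesis mX : measurable X.
Implicit Types v w : T -> R[i].

Lemma measurable_normc_sqr v : measurable_fun X v ->
  measurable_fun X (fun x => (Normc.normc (v x) ^+ 2)%:E).
Proof.
move=> /measurable_fun_complexP[mRe mIm]; apply/measurable_EFinP.
rewrite (_ : (fun x => _) = fun x =>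
    complex.Re (v x) ^+ 2 + complex.Im (v x) ^+ 2); last first.
  by apply/funext => x; case: (v x) => a b /=; rewrite sqr_sqrtr// addr_ge0 ?sqr_ge0.
by apply: measurable_funD; exact: measurable_funX.
Qed.

Lemma integral_normc_sqr_ge0 v :
  (0 <= \int[mu]_(x in X) (Normc.normc (v x) ^+ 2)%:E)%E.
Proof. by apply: integral_ge0 => x _; rewrite lee_fin sqr_ge0. Qed.

Lemma L2norm_ge0 v : 0 <= L2norm X mu v.
Proof. exact: sqrtr_ge0. Qed.

Lemma L2norm_sqr v : L2 X mu v ->
  (\int[mu]_(x in X) (Normc.normc (v x) ^+ 2)%:E = (L2norm X mu v ^+ 2)%:E)%E.
Proof.
move=> [_ fv]; have i0 := integral_normc_sqr_ge0 v.
by rewrite /L2norm sqr_sqrtr ?fine_ge0// fineK// ge0_fin_numE.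
Qed.

(** The real bound [k ^+ 2] makes the integral finite, so that [fine] keeps its
value: this is how an inequality between integrals becomes one between norms. *)
Lemma L2norm_le v (k : R) : 0 <= k ->
  (\int[mu]_(x in X) (Normc.normc (v x) ^+ 2)%:E <= (k ^+ 2)%:E)%E ->
  L2norm X mu v <= k.
Proof.
move=> k0 ik; have i0 := integral_normc_sqr_ge0 v.
have fi : (\int[mu]_(x in X) (Normc.normc (v x) ^+ 2)%:E)%E \is a fin_num.
  by rewrite ge0_fin_numE// (le_lt_trans ik)// ltry.
rewrite -[leRHS]ger0_norm// -sqrtr_sqr /L2norm ler_wsqrtr//.
by rewrite -lee_fin fineK.
Qed.

Lemma L2norm_dom v w (k : R) : 0 <= k -> L2 X mu v -> measurable_fun X w ->
  (forall x, Normc.normc (w x) <= k * Normc.normc (v x)) ->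
  L2norm X mu w <= k * L2norm X mu v.
Proof.
move=> k0 v2 mw wv; have mv := measurable_normc_sqr v2.1.
apply: L2norm_le; first by rewrite mulr_ge0 ?L2norm_ge0.
rewrite exprMn EFinM -L2norm_sqr// -ge0_integralZl//.
- apply: ge0_le_integral => //.
  + by move=> x _; rewrite lee_fin sqr_ge0.
  + exact: measurable_normc_sqr.
  + exact: measurable_funeM.
  + move=> x _; rewrite -EFinM lee_fin -exprMn.
    by rewrite ler_pXn2r ?nnegrE ?mulr_ge0 ?normc_ge0.
- by move=> x _; rewrite lee_fin sqr_ge0.
- by rewrite lee_fin sqr_ge0.
Qed.

(** Convexity of the square at [a / A] and [b / B], with weights proportional
to [A] and [B]. *)
Lemma sqrD_le_weighted (a b A B : R) : 0 < A -> 0 < B ->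
  (a + b) ^+ 2 <= (A + B) / A * a ^+ 2 + (A + B) / B * b ^+ 2.
Proof.
move=> A0 B0; rewrite -subr_ge0.
rewrite (_ : _ - _ = (B * a - A * b) ^+ 2 / (A * B)); last first.
  by field; rewrite !gt_eqF.
by rewrite divr_ge0 ?sqr_ge0// mulr_ge0 ?ltW.
Qed.

(** Minkowski's inequality.  For [A] and [B] positive, at least the norms of
[v] and [w], the weighted convexity inequality integrates to the upper bound
[(A + B) ^ 2]; letting [A] and [B] decrease to the norms, rather than taking
them equal to the norms, covers the case of a vanishing norm. *)
Lemma L2normD v w : L2 X mu v -> L2 X mu w ->
  L2norm X mu (v \+ w) <= L2norm X mu v + L2norm X mu w.
Proof.
move=> v2 w2; apply/ler_addgt0Pr => e e0.
have [v0 w0] := (L2norm_ge0 v, L2norm_ge0 w).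
have [mv mw] := (measurable_normc_sqr v2.1, measurable_normc_sqr w2.1).
set A := L2norm X mu v + e / 2; set B := L2norm X mu w + e / 2.
have vA : L2norm X mu v <= A by rewrite lerDl; lra.
have wB : L2norm X mu w <= B by rewrite lerDl; lra.
have A0 : 0 < A by rewrite /A; lra.
have B0 : 0 < B by rewrite /B; lra.
rewrite (_ : _ + e = A + B); last by rewrite /A /B; field.
have AB0 : 0 < A + B by rewrite addr_gt0.
have a0 : 0 <= (A + B) / A by rewrite divr_ge0 ?ltW.
have b0 : 0 <= (A + B) / B by rewrite divr_ge0 ?ltW.
apply: L2norm_le; first exact: ltW.
apply: (@le_trans _ _ (\int[mu]_(x in X)
    (((A + B) / A)%:E * (Normc.normc (v x) ^+ 2)%:E +
     ((A + B) / B)%:E * (Normc.normc (w x) ^+ 2)%:E))%E).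
  apply: ge0_le_integral => //.
  - by move=> x _; rewrite lee_fin sqr_ge0.
  - by apply: measurable_normc_sqr; exact: (L2D mX v2 w2).1.
  - by apply: emeasurable_funD; exact: measurable_funeM.
  move=> x _; rewrite -!EFinM -EFinD lee_fin.
  apply: le_trans (sqrD_le_weighted _ _ A0 B0).
  by rewrite ler_pXn2r ?nnegrE ?addr_ge0 ?normc_ge0//; exact: le_normcD.
have nonneg z (k : R) : 0 <= k ->
    forall x, X x -> (0 <= k%:E * (Normc.normc (z x) ^+ 2)%:E)%E.
  by move=> k0 x _; rewrite -EFinM lee_fin mulr_ge0 ?sqr_ge0.
rewrite (ge0_integralD _ mX (nonneg v _ a0) _ (nonneg w _ b0));
  [|exact: measurable_funeM|exact: measurable_funeM].
rewrite !ge0_integralZl// ?lee_fin//; last first.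
- by move=> x _; rewrite lee_fin sqr_ge0.
- by move=> x _; rewrite lee_fin sqr_ge0.
rewrite !L2norm_sqr// -!EFinM -EFinD lee_fin.
rewrite (_ : (A + B) ^+ 2 = (A + B) / A * A ^+ 2 + (A + B) / B * B ^+ 2).
  by apply: lerD; apply: ler_wpM2l => //; rewrite lerXn2r// nnegrE ltW.
by field; rewrite !gt_eqF.
Qed.

Lemma L2B v w : L2 X mu v -> L2 X mu w -> L2 X mu (v \- w).
Proof.
move=> v2 w2; rewrite (_ : v \- w = v \+ (fun x => -1 * w x)).
  by apply: L2D => //; exact: L2Z.
by apply/funext => x /=; rewrite mulN1r.
Qed.

Lemma L2normZ_le (a : R[i]) v : L2 X mu v ->
  L2norm X mu (fun x => a * v x) <= Normc.normc a * L2norm X mu v.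
Proof.
move=> v2; apply: L2norm_dom => //; first exact: normc_ge0.
  by have [] := L2Z mX a v2.
by move=> x; rewrite Normc.normcM.
Qed.

Lemma L2norm0 : L2norm X mu (fun=> 0) = 0.
Proof.
rewrite /L2norm integral0_eq ?sqrtr0// => x _.
by rewrite Normc.normc0 expr0n.
Qed.

(** * The synthesis operator *)

Lemma L2norm_synthesis_le n (phi : 'I_n -> T -> R[i]) (c : 'cV[R[i]]_n) :
  (forall i, L2 X mu (phi i)) ->
  L2norm X mu (synthesis phi c) <=
    \sum_(i < n) Normc.normc (c i ord0) * L2norm X mu (phi i).
Proof.
move=> phi2; rewrite (_ : synthesis phi c =
    \sum_(i < n) (fun x => c i ord0 * phi i x)); last first.
  by apply/funext => x; rewrite fct_sumE.
(* membership in L2 is carried along the induction, for [L2normD] *)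
suff [] : L2 X mu (\sum_(i < n) (fun x => c i ord0 * phi i x)) /\
    L2norm X mu (\sum_(i < n) (fun x => c i ord0 * phi i x)) <=
    \sum_(i < n) Normc.normc (c i ord0) * L2norm X mu (phi i) by [].
apply: (big_ind2 (fun w (k : R) => L2 X mu w /\ L2norm X mu w <= k)).
- split; last by rewrite L2norm0.
  split; first exact: measurable_cst.
  rewrite integral0_eq ?ltry// => x _.
  by rewrite Normc.normc0 expr0n.
- move=> v k w l [v2 vk] [w2 wl]; split; first exact: L2D.
  by apply: le_trans (L2normD v2 w2) _; exact: lerD.
- by move=> i _; split; [exact: L2Z|exact: L2normZ_le].
Qed.

Lemma l2norm_ge0 n (c : 'cV[R[i]]_n) : 0 <= l2norm c.
Proof. exact: sqrtr_ge0. Qed.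

Lemma normc_le_l2norm n (c : 'cV[R[i]]_n) i : Normc.normc (c i ord0) <= l2norm c.
Proof.
rewrite -[leLHS]ger0_norm ?normc_ge0// -sqrtr_sqr /l2norm ler_wsqrtr//.
by rewrite (bigD1 i)//= lerDl sumr_ge0// => j _; rewrite sqr_ge0.
Qed.

(** Cauchy-Schwarz against the all-ones vector: the defect is half of the double
sum of the squares [(a i - a j) ^+ 2]. *)
Lemma sqr_sum_le n (a : 'I_n -> R) :
  (\sum_(i < n) a i) ^+ 2 <= n%:R * \sum_(i < n) a i ^+ 2.
Proof.
have : 0 <= \sum_(i < n) \sum_(j < n) (a i - a j) ^+ 2.
  by do 2!apply: sumr_ge0 => ? _; rewrite sqr_ge0.
set S := \sum_i a i; set Q := \sum_i a i ^+ 2.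
have -> : \sum_(i < n) \sum_(j < n) (a i - a j) ^+ 2 =
    \sum_(i < n) (n%:R * a i ^+ 2 - 2 * S * a i + Q).
  apply: eq_bigr => i _; rewrite (eq_bigr (fun j =>
      a i ^+ 2 + ((- (2 * a i)) * a j + a j ^+ 2))); last by move=> j _; ring.
  rewrite !big_split/= sumr_const card_ord -mulr_sumr -/S -/Q.
  by rewrite -[X in X + _]mulr_natl; ring.
rewrite big_split/= sumrB -!mulr_sumr sumr_const card_ord -/S -/Q -(mulr_natl Q).
by move=> ?; lra.
Qed.

Lemma sum_normc_le_l2norm n (c : 'cV[R[i]]_n) :
  \sum_(i < n) Normc.normc (c i ord0) <= Num.sqrt n%:R * l2norm c.
Proof.
rewrite -[leLHS]ger0_norm ?sumr_ge0// => [|i _]; last exact: normc_ge0.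
by rewrite -sqrtr_sqr /l2norm -sqrtrM ?ler0n// ler_wsqrtr// sqr_sum_le.
Qed.

(** The supremum defining [opnorm] is that of a bounded set, so that it is an
upper bound and can be tested on the i-th unit vector. *)
Lemma L2norm_le_opnorm n (phi : 'I_n -> T -> R[i]) i :
  (forall i, L2 X mu (phi i)) ->
  L2norm X mu (phi i) <= opnorm X mu (synthesis phi).
Proof.
move=> phi2.
pose e : 'cV[R[i]]_n := delta_mx i ord0.
have phiE : synthesis phi e = phi i.
  apply/funext => x; rewrite /synthesis (bigD1 i)//= big1 ?addr0.
    by rewrite mxE !eqxx mul1r.
  by move=> j ji; rewrite mxE (negbTE ji) mul0r.
have l2e : l2norm e = 1.
  rewrite /l2norm (bigD1 i)//= big1 ?addr0.
    by rewrite mxE !eqxx Normc.normc1 expr1n sqrtr1.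
  by move=> j ji; rewrite mxE (negbTE ji) Normc.normc0 expr0n.
rewrite /opnorm; apply: ub_le_sup; last first.
  exists e; last by rewrite phiE l2e divr1.
  apply/eqP => e0; move: l2e; rewrite e0 /l2norm big1 ?sqrtr0.
    by move/eqP; rewrite eq_sym oner_eq0.
  by move=> j _; rewrite mxE Normc.normc0 expr0n.
exists (\sum_(j < n) L2norm X mu (phi j)) => _ [c _ <-].
have [c0|c0] := eqVneq (l2norm c) 0.
  by rewrite c0 invr0 mulr0 sumr_ge0// => j _; exact: L2norm_ge0.
rewrite ler_pdivrMr ?lt_def ?c0 ?l2norm_ge0//.
apply: le_trans (L2norm_synthesis_le c phi2) _.
rewrite mulr_suml; apply: ler_sum => j _; rewrite mulrC.
by rewrite ler_wpM2l ?L2norm_ge0// normc_le_l2norm.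
Qed.

(** * Rounding errors *)

Lemma L2norm_fl_sub (u : R) (fl : R[i] -> R[i]) v :
  rounding_map u fl -> L2 X mu v ->
  L2norm X mu ((fl \o v) \- v) <= u * L2norm X mu v.
Proof.
move=> flr v2; have [_ flP] := flr.
apply: L2norm_dom => //.
- by have [dl [dlu _]] := flP 0; exact: le_trans (normc_ge0 _) dlu.
- by have [] := L2B (L2_fl mX flr v2) v2.
move=> x /=; have [dl [dlu ->]] := flP (v x).
rewrite mulrDr mulr1 addrAC subrr add0r Normc.normcM mulrC.
by rewrite ler_wpM2r ?normc_ge0.
Qed.

Lemma L2norm_fl_sub_sym (u : R) (fl : R[i] -> R[i]) v :
  rounding_map u fl -> L2 X mu v ->
  L2norm X mu (v \- (fl \o v)) <= u * L2norm X mu v.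
Proof.
move=> flr v2; apply: le_trans (L2norm_fl_sub flr v2).
have fv2 := L2_fl mX flr v2.
rewrite -[leRHS]mul1r; apply: L2norm_dom => //; first exact: L2B.
  by have [] := L2B v2 fv2.
by move=> x /=; rewrite mul1r -opprB normcN.
Qed.

(** The rounding error of T is itself a synthesis operator, with small elements
[fl(phi_i) - phi_i].  The factor [sqrt n] comes from bounding its terms one by
one instead of their sum. *)
Lemma L2norm_rounding_perturbation (u : R) (fl : R[i] -> R[i]) n
    (phi : 'I_n -> T -> R[i]) (c : 'cV[R[i]]_n) :
  0 <= u -> rounding_map u fl -> (forall i, L2 X mu (phi i)) ->
  L2norm X mu (synthesis (fun i => (fl \o phi i) \- phi i) c) <=
    u * Num.sqrt n%:R * opnorm X mu (synthesis phi) * l2norm c.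
Proof.
move=> u0 flr phi2.
have phifl2 i : L2 X mu ((fl \o phi i) \- phi i).
  by apply: L2B => //; exact: L2_fl flr (phi2 i).
(* an index is needed to see that the operator norm is nonnegative *)
case: n phi c phi2 phifl2 => [|n] phi c phi2 phifl2.
  by rewrite (le_trans (L2norm_synthesis_le c phifl2))// big_ord0 sqrtr0 mulr0 !mul0r.
have op0 : 0 <= opnorm X mu (synthesis phi).
  exact: le_trans (L2norm_ge0 _) (L2norm_le_opnorm ord0 phi2).
apply: le_trans (L2norm_synthesis_le c phifl2) _.
apply: (@le_trans _ _ ((\sum_i Normc.normc (c i ord0)) *
    (u * opnorm X mu (synthesis phi)))).
  rewrite mulr_suml; apply: ler_sum => i _.
  rewrite ler_wpM2l ?normc_ge0//.
  apply: le_trans (L2norm_fl_sub flr (phi2 i)) _.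
  by rewrite ler_wpM2l// L2norm_le_opnorm.
apply: (@le_trans _ _ (Num.sqrt n.+1%:R * l2norm c *
    (u * opnorm X mu (synthesis phi)))).
  by rewrite ler_wpM2r ?mulr_ge0// sum_normc_le_l2norm.
by rewrite le_eqVlt; apply/orP; left; apply/eqP; ring.
Qed.

End L2norm_theory.

(** * Regularized approximation with a rounded synthesis operator *)

Theorem theorem11 (R : realType) (d : nat) (X : set (d.-tuple R))
    (rho : probability (d.-tuple R) R)
    (mX : measurable X) (rhoX : rho X = 1%E) (rho_nonatomic : nonatomic rho)
    (u : R) (u_gt0 : 0 < u) (fl : R[i] -> R[i]) (fl_round : rounding_map u fl)
    (n : nat) (phi : 'I_n -> d.-tuple R -> R[i])
    (phi_L2 : forall i, L2 X rho (phi i))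
    (f : d.-tuple R -> R[i]) (f_L2 : L2 X rho f)
    (C eps : R) (C_ge1 : 1 <= C)
    (eps_ge : u * Num.sqrt n%:R * opnorm X rho (synthesis phi) <= eps)
    (E := fun c : 'cV[R[i]]_n =>
       L2norm X rho (synthesis phi c \- f) + eps * l2norm c)
    (chat : 'cV[R[i]]_n) (chat_quasimin : E chat <= C * inf (range E)) :
  L2norm X rho (fl_synthesis fl phi chat \- (fl \o f)) <=
    C * inf (range E) + u * L2norm X rho f.
Proof.
have Tf2 : L2 X rho (synthesis phi chat \- f).
  by apply: L2B => //; exact: L2_synthesis.
have phifl2 i : L2 X rho ((fl \o phi i) \- phi i).
  by apply: L2B => //; exact: L2_fl fl_round (phi_L2 i).
have S2 : L2 X rho (synthesis (fun i => (fl \o phi i) \- phi i) chat).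
  exact: L2_synthesis.
have ff2 : L2 X rho (f \- (fl \o f)).
  by apply: L2B => //; exact: L2_fl fl_round f_L2.
have -> : fl_synthesis fl phi chat \- (fl \o f) =
    (synthesis phi chat \- f) \+
    synthesis (fun i => (fl \o phi i) \- phi i) chat \+ (f \- (fl \o f)).
  apply/funext => x; rewrite /fl_synthesis /synthesis /=.
  under [X in _ = _ + X + _]eq_bigr => i _ do rewrite mulrBr.
  by rewrite sumrB; ring.
apply: le_trans (L2normD mX (L2D mX Tf2 S2) ff2) _.
apply: lerD; last exact: L2norm_fl_sub_sym fl_round f_L2.
apply: le_trans (L2normD mX Tf2 S2) _.
apply: le_trans chat_quasimin; rewrite /E lerD2l.
have u0 := ltW u_gt0.
apply: le_trans (L2norm_rounding_perturbation mX chat u0 fl_round phi_L2) _.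
by rewrite ler_wpM2r ?l2norm_ge0.
Qed.
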